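(* Let $1\le p\le\infty$, $n\ge2$, $0<\epsilon<1$, $0<\delta<1/2$. Any algorithm that solves the uniformity testing problem for $\ell_p$ distance with tolerance $\epsilon$ and failure probability $\delta$ on support size $n$ must draw at least \[ m=\begin{cases}\dfrac12\,\dfrac{\ln\left(1+n(1-2\delta)^2\right)}{n\epsilon^2} & \text{for all } n,\\[1em] \dfrac{1-2\delta}{2}\,\dfrac1\epsilon & \text{if } n\ge\frac1\epsilon\end{cases}\] samples (i.e. the first bound holds for every $n$, and the second additionally holds when $n\ge1/\epsilon$).
   Context: A distribution on support size $n$ is a vector $A\in\mathbb{R}^n$, $A_i\ge0$, $\sum_iA_i=1$; $U_n$ is uniform; $\|V\|_p=(\sum_i|V_i|^p)^{1/p}$, $\|V\|_\infty=\max_i|V_i|$. Uniformity testing: given $p,n,\epsilon,\delta$ and i.i.d. samples from an unknown distribution $A$ on $\{1,\dots,n\}$, the algorithm draws some number $m$ of samples and must output ``uniform'' with probability at least $1-\delta$ if $A=U_n$, and ``not uniform'' with probability at least $1-\delta$ if $\|A-U_n\|_p\ge\epsilon$.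
   Formalization: The formal theorem also assumes that some distribution A has ‖A−U_n‖_p ≥ ε; without this (e.g. p=∞, n=2, ε=0.9) the algorithm that draws no samples and always says ''uniform'' solves the problem, and the claimed bounds fail. *)

(* Defs.v *)
From HB Require Import structures.
From mathcomp Require Import all_boot all_order all_algebra.
From mathcomp Require Import all_classical all_reals all_analysis.

Set Implicit Arguments.
Unset Strict Implicit.
Unset Printing Implicit Defensive.

Import Order.TTheory GRing.Theory Num.Theory.
Local Open Scope ring_scope.

Definition is_distribution (R : realType) (T : finType) (A : {ffun T -> R}) : Prop :=
  (forall i, 0 <= A i) /\ \sum_i A i = 1.

Definition uniform_distribution (R : realType) (n : nat) : {ffun 'I_n -> R} :=
  [ffun _ => n%:R^-1].

(* Meaningful for 1 <= p <= +oo only; the value at p = -oo is junk. *)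
Definition lp_norm (R : realType) (n : nat) (p : \bar R) (V : {ffun 'I_n -> R}) : R :=
  match p with
  | EFin q => (\sum_i `|V i| `^ q) `^ q^-1
  | EPInf => \big[Num.max/0]_i `|V i|
  | ENInf => 0
  end.

(* A (possibly randomized) algorithm drawing m samples from 'I_n: to each
   sample vector it associates the law of its verdict, where [true] stands for
   "uniform" and [false] for "not uniform". *)
Definition algorithm (R : realType) (m n : nat) : Type :=
  {ffun 'I_m -> 'I_n} -> {ffun bool -> R}.

Definition is_algorithm (R : realType) (m n : nat) (T : algorithm R m n) : Prop :=
  forall x, is_distribution (T x).

(* Probability of the verdict b when the m samples are i.i.d. with law A. *)
Definition verdict_prob (R : realType) (m n : nat) (T : algorithm R m n)
    (A : {ffun 'I_n -> R}) (b : bool) : R :=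
  \sum_(x : {ffun 'I_m -> 'I_n}) (\prod_(j < m) A (x j)) * T x b.

Definition lp_far_from_uniform (R : realType) (n : nat) (p : \bar R) (eps : R)
    (A : {ffun 'I_n -> R}) : Prop :=
  eps <= lp_norm p (A - uniform_distribution R n).

Definition solves_uniformity_testing (R : realType) (m n : nat) (p : \bar R)
    (eps delta : R) (T : algorithm R m n) : Prop :=
  forall A : {ffun 'I_n -> R}, is_distribution A ->
    (A = uniform_distribution R n -> 1 - delta <= verdict_prob T A true) /\
    (lp_far_from_uniform p eps A -> 1 - delta <= verdict_prob T A false).

(* Main.v *)
(* For eps <= 1/2, raise one coordinate i of the uniform distribution by eps and
   lower the others equally: this is A_i = (1 - th) U + th e_i with
   th (1 - 1/n) = eps, and it is eps-far from U in every l_p norm since already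
   |A_i(i) - 1/n| = eps.

   First bound: take i uniformly at random.  The likelihood ratios satisfy
   n <A_i, A_k> = 1 - th^2 + n th^2 [i = k], so the chi-squared divergence of the
   mixture of the A_i^m from U^m is at most (exp (m (n-1) th^2) - 1) / n, and by
   Cauchy-Schwarz it bounds the squared advantage (1 - 2 delta)^2 of any test.
   Finally (n-1) th^2 = n^2 eps^2 / (n-1) <= 2 n eps^2.

   Second bound: with probability (1 - th)^m >= 1 - m th no sample comes from
   the spike, whence 1 - 2 delta <= m th <= 2 m eps.

   For eps > 1/2, both bounds are at most 2, and one sample from a uniformly
   random rotation of any far distribution is uniform, so m >= 2. *)
Require Import Defs.
From HB Require Import structures.
From mathcomp Require Import all_boot all_order all_algebra.
From mathcomp Require Import all_classical all_reals all_analysis.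
From mathcomp Require Import ring lra.

Set Implicit Arguments.
Unset Strict Implicit.
Unset Printing Implicit Defensive.

Import Order.TTheory GRing.Theory Num.Theory.
Local Open Scope ring_scope.

(** * Verdict probabilities under i.i.d. samples *)

Lemma prod_const_ord (R : realType) (m : nat) (c : R) :
  \prod_(j < m) c = c ^+ m.
Proof. by rewrite prodr_const card_ord. Qed.

Lemma sum_prod_ffun (R : realType) (m n : nat) (F : 'I_n -> R) :
  \sum_(x : {ffun 'I_m -> 'I_n}) \prod_(j < m) F (x j) = (\sum_i F i) ^+ m.
Proof. by rewrite -prod_const_ord bigA_distr_bigA. Qed.

Lemma verdict_prob_sum (R : realType) (m n : nat) (T : algorithm R m n)
    (A : {ffun 'I_n -> R}) :
  is_algorithm T -> is_distribution A ->
  verdict_prob T A true + verdict_prob T A false = 1.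
Proof.
move=> hT [_ A1]; rewrite /verdict_prob -big_split /=.
under eq_bigr => x _ do rewrite -mulrDr.
transitivity ((\sum_i A i) ^+ m); last by rewrite A1 expr1n.
rewrite -sum_prod_ffun; apply: eq_bigr => x _.
by have [_] := hT x; rewrite big_bool /= => ->; rewrite mulr1.
Qed.

Lemma is_distribution_bounds (R : realType) (f : {ffun bool -> R}) (b : bool) :
  is_distribution f -> 0 <= f b <= 1.
Proof.
move=> [f0 <-]; rewrite f0 big_bool /=.
by case: b; rewrite ?lerDl ?lerDr f0.
Qed.

Lemma is_distribution_uniform (R : realType) (n : nat) :
  (0 < n)%N -> is_distribution (uniform_distribution R n).
Proof.
move=> n_gt0; split=> [i|]; first by rewrite ffunE invr_ge0.
under eq_bigr => i _ do rewrite ffunE.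
by rewrite sumr_const card_ord -[LHS]mulr_natr mulVf// pnatr_eq0 -lt0n.
Qed.

Lemma verdict_prob_uniform (R : realType) (m n : nat) (T : algorithm R m n) b :
  verdict_prob T (uniform_distribution R n) b =
  \sum_(x : {ffun 'I_m -> 'I_n}) n%:R^-1 ^+ m * T x b.
Proof.
rewrite /verdict_prob; apply: eq_bigr => x _; congr (_ * _).
by rewrite -prod_const_ord; apply: eq_bigr => j _; rewrite ffunE.
Qed.

(** * Norms, rotations and the need for two samples *)

Lemma le_coord_lp_norm (R : realType) (n : nat) (p : \bar R)
    (V : {ffun 'I_n -> R}) (i : 'I_n) :
  (1%:E <= p)%E -> `|V i| <= lp_norm p V.
Proof.
case: p => [q||]; rewrite /lp_norm //.
- rewrite lee_fin => q1; have q0 : 0 < q by apply: lt_le_trans q1.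
  have -> : `|V i| = (`|V i| `^ q) `^ q^-1.
    by rewrite -powRrM mulfV ?gt_eqF// powRr1.
  apply: ge0_ler_powR.
  + by rewrite invr_ge0 ltW.
  + by rewrite nnegrE powR_ge0.
  + by rewrite nnegrE sumr_ge0// => j _; exact: powR_ge0.
  + by rewrite (bigD1 i)//= lerDl sumr_ge0// => j _; exact: powR_ge0.
- by move=> _; exact: le_bigmax.
Qed.

Lemma lp_norm_reindex (R : realType) (n : nat) (p : \bar R)
    (V : {ffun 'I_n -> R}) (s : 'I_n -> 'I_n) :
  bijective s -> lp_norm p [ffun i => V (s i)] = lp_norm p V.
Proof.
move=> bs; have rs (F : 'I_n -> R) (op : SemiGroup.com_law R) x :
    \big[op/x]_i F (s i) = \big[op/x]_i F i.
  by rewrite [RHS](reindex s)//; exact: onW_bij.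
case: p => [q||]; rewrite /lp_norm.
- congr (_ `^ _); rewrite -[RHS]rs.
  by apply: eq_bigr => i _; rewrite ffunE.
- rewrite -[RHS]rs.
  by apply: eq_bigr => i _; rewrite ffunE.
- by [].
Qed.

(* The left-hand side counts, up to a factor [n], the likelihood of [x] under
   a uniformly random rotation of [A]: with at most one sample, this mixture
   cannot be told apart from the uniform distribution. *)
Lemma sum_rotations (R : realType) (m n : nat) (A : {ffun 'I_n.+1 -> R})
    (x : {ffun 'I_m -> 'I_n.+1}) :
  is_distribution A -> (m <= 1)%N ->
  \sum_(s : 'I_n.+1) \prod_(j < m) A (x j + s) =
  \sum_(s : 'I_n.+1) n.+1%:R^-1 ^+ m.
Proof.
move=> [_ A1]; case: m x => [|[|//]] x _.
  by apply: eq_bigr => s _; rewrite big_ord0 expr0.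
under eq_bigr => s _ do rewrite big_ord1.
rewrite sumr_const card_ord expr1 -[RHS]mulr_natr mulVf ?pnatr_eq0//.
by rewrite -[RHS]A1 [RHS](reindex_inj (addrI (x ord0))).
Qed.

(** With at most one sample, the probability of [false] averaged over all rotations of [A] equals
    that under the uniform law, at most [delta]. But each rotation is as far as [A], so the average
    is at least [1 - delta > delta]. *)
Lemma two_samples_needed (R : realType) (p : \bar R) (n : nat) (eps delta : R)
    (m : nat) (T : algorithm R m n.+1) (A : {ffun 'I_n.+1 -> R}) :
  delta < 2^-1 -> is_distribution A -> lp_far_from_uniform p eps A ->
  is_algorithm T -> solves_uniformity_testing p eps delta T -> (2 <= m)%N.
Proof.
move=> hd hA farA hT hs; rewrite ltnNge; apply/negP => m1.
pose U := uniform_distribution R n.+1.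
pose B s : {ffun 'I_n.+1 -> R} := [ffun i => A (i + s)].
have bij_s s : bijective (fun i : 'I_n.+1 => i + s).
  by exists (fun i => i - s) => i; rewrite ?addrK ?subrK.
have hB s : is_distribution (B s).
  split=> [i|]; first by rewrite ffunE hA.1.
  rewrite -hA.2 [RHS](reindex _ (onW_bij _ (bij_s s))) /=.
  by apply: eq_bigr => i _; rewrite ffunE.
have farB s : lp_far_from_uniform p eps (B s).
  rewrite /lp_far_from_uniform; apply: le_trans farA _.
  rewrite -(lp_norm_reindex _ (A - _) (bij_s s)).
  by rewrite le_eqVlt (_ : [ffun _ => _] = B s - U) ?eqxx//;
    apply/ffunP => i; rewrite !ffunE.
have hU : is_distribution U by exact: is_distribution_uniform.
have hUt : 1 - delta <= verdict_prob T U true by apply: (hs U hU).1.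
have hUtf := verdict_prob_sum hT hU.
have : \sum_(s : 'I_n.+1) verdict_prob T (B s) false =
       \sum_(s : 'I_n.+1) verdict_prob T U false.
  rewrite verdict_prob_uniform /verdict_prob exchange_big [RHS]exchange_big /=.
  apply: eq_bigr => x _; rewrite -!mulr_suml -(@sum_rotations _ _ _ A x)//.
  by congr (_ * _); apply: eq_bigr => s _; apply: eq_bigr => j _; rewrite ffunE.
apply/eqP; rewrite gt_eqF//; apply: ltr_sum.
  by apply/hasP; exists ord0; rewrite ?mem_index_enum.
move=> s _; have := (hs (B s) (hB s)).2 (farB s).
move: hUt hUtf hd; lra.
Qed.

(* The right-hand side is the chi-squared divergence of [Q]
   from the uniform distribution on [X]. *)
Lemma test_advantage_le_chi2 (R : realType) (X : finType) (Q t : X -> R) :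
  (0 < #|X|)%N -> (forall x, 0 <= t x <= 1) -> \sum_x Q x = 1 ->
  (\sum_x (#|X|%:R^-1 - Q x) * t x) ^+ 2 <= #|X|%:R * (\sum_x Q x ^+ 2) - 1.
Proof.
move=> X0 ht Q1; set N : R := #|X|%:R.
have N0 : 0 < N by rewrite ltr0n.
(* Cauchy-Schwarz by expanding the nonnegative sum of [(D x - c * t x) ^+ 2]; this [c] is the
   minimizer once the sum of [t x ^+ 2] is replaced by its bound [N]. *)
set S := \sum_x _; pose c := S / N.
pose D x := N^-1 - Q x.
have D2 : \sum_x D x ^+ 2 = \sum_x Q x ^+ 2 - N^-1.
  transitivity (\sum_x (N^-2 - 2 * N^-1 * Q x + Q x ^+ 2)).
    by apply: eq_bigr => x _; rewrite /D; field; rewrite gt_eqF.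
  rewrite big_split sumrB /= -mulr_sumr Q1 sumr_const -mulr_natl -/N.
  by field; rewrite gt_eqF.
have t2 : \sum_x t x ^+ 2 <= N.
  have -> : N = \sum_(x : X) 1 by rewrite sumr_const.
  by apply: ler_sum => x _; have /andP[? ?] := ht x; rewrite expr_le1.
have : 0 <= \sum_x (D x - c * t x) ^+ 2 by apply: sumr_ge0 => x _; exact: sqr_ge0.
have -> : \sum_x (D x - c * t x) ^+ 2 =
          \sum_x D x ^+ 2 - 2 * c * S + c ^+ 2 * \sum_x t x ^+ 2.
  rewrite !mulr_sumr -sumrB -big_split /=.
  by apply: eq_bigr => x _; rewrite /D; ring.
have : c ^+ 2 * \sum_x t x ^+ 2 <= c ^+ 2 * N by rewrite ler_wpM2l ?sqr_ge0.
rewrite D2 => h1 h2.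
have h3 : 0 <= \sum_x Q x ^+ 2 - N^-1 - 2 * c * S + c ^+ 2 * N.
  by apply: le_trans h2 _; rewrite lerD2l.
have := mulr_ge0 (ltW N0) h3.
have -> : N * (\sum_x Q x ^+ 2 - N^-1 - 2 * c * S + c ^+ 2 * N) =
          N * (\sum_x Q x ^+ 2) - 1 - S ^+ 2.
  by rewrite /c; field; rewrite gt_eqF.
by rewrite subr_ge0.
Qed.

(** * Spikes: second moment, distance and sample bounds *)

Definition spike (R : realType) (n : nat) (th : R) (i : 'I_n) : {ffun 'I_n -> R} :=
  [ffun j => (1 - th) / n%:R + th * (j == i)%:R].

Lemma sum_delta (R : realType) (n : nat) (f : 'I_n -> R) (i : 'I_n) :
  \sum_j f j * (j == i)%:R = f i.
Proof.
rewrite (bigD1 i)//= eqxx mulr1 big1 ?addr0// => j /negPf->.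
by rewrite mulr0.
Qed.

Lemma is_distribution_spike (R : realType) (n : nat) (th : R) (i : 'I_n) :
  0 <= th <= 1 -> is_distribution (spike th i).
Proof.
move=> /andP[th0 th1]; split=> [j|].
  by rewrite ffunE addr_ge0 ?mulr_ge0 ?invr_ge0 ?subr_ge0.
have n0 : n%:R != 0 :> R by rewrite pnatr_eq0; case: (n) i => [[]|].
under eq_bigr => j _ do rewrite ffunE.
rewrite big_split /= sum_delta sumr_const card_ord -mulr_natr.
by field.
Qed.

Lemma spike_inner (R : realType) (n : nat) (th : R) (i k : 'I_n) :
  n%:R * \sum_j spike th i j * spike th k j =
  1 - th ^+ 2 + n%:R * th ^+ 2 * (i == k)%:R.
Proof.
have n0 : n%:R != 0 :> R by rewrite pnatr_eq0; case: (n) i => [[]|].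
pose a : R := (1 - th) / n%:R.
have -> : \sum_j spike th i j * spike th k j =
  \sum_(j < n) a ^+ 2 + \sum_(j < n) (a * th) * (j == i)%:R
  + \sum_(j < n) (a * th + th ^+ 2 * (j == i)%:R) * (j == k)%:R.
  by rewrite -!big_split /=; apply: eq_bigr => j _; rewrite !ffunE /a; ring.
rewrite !sum_delta sumr_const card_ord -mulr_natl (eq_sym k i) /a.
by field.
Qed.

(* The left-hand side is the chi-squared divergence from uniform of [m] samples
   drawn from a spike at a uniformly random place. *)
Lemma spike_second_moment (R : realType) (m n : nat) (th : R) :
  (0 < n)%N -> 0 <= th <= 1 ->
  n%:R ^+ m * (\sum_(x : {ffun 'I_m -> 'I_n})
     (n%:R^-1 * \sum_i \prod_(j < m) spike th i (x j)) ^+ 2) - 1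
  <= n%:R^-1 * (expR (m%:R * (n%:R - 1) * th ^+ 2) - 1).
Proof.
move=> n_gt0 /andP[th0 th1].
have n0 : 0 < n%:R :> R by rewrite ltr0n.
have -> : n%:R ^+ m * (\sum_(x : {ffun 'I_m -> 'I_n})
     (n%:R^-1 * \sum_i \prod_(j < m) spike th i (x j)) ^+ 2) =
  n%:R ^- 2 * \sum_i \sum_k (1 - th ^+ 2 + n%:R * th ^+ 2 * (i == k :> 'I_n)%:R) ^+ m.
  (* Squaring the mixture gives a sum over pairs of spikes; for each pair, summing over the samples
     factorizes into the [m]-th power of an inner product. *)
  under [in RHS]eq_bigr => i _ do under eq_bigr => k _ do
    rewrite -spike_inner exprMn -sum_prod_ffun.
  under [in LHS]eq_bigr => x _ do rewrite exprMn exprVn.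
  rewrite -mulr_sumr mulrCA; congr (_ * _).
  under [RHS]eq_bigr => i _ do rewrite -mulr_sumr exchange_big /=.
  rewrite -mulr_sumr exchange_big /=; congr (_ * _); apply: eq_bigr => x _.
  rewrite expr2 mulr_suml; apply: eq_bigr => i _.
  by rewrite mulr_sumr; apply: eq_bigr => k _; rewrite -big_split.
set E := expR _.
(* The diagonal entry is at most [E] by [1 + y <= expR y] at [y = (n - 1) th^2]; each of the [n - 1]
   others is at most 1. *)
have hrow i : \sum_(k < n) (1 - th ^+ 2 + n%:R * th ^+ 2 * (i == k)%:R) ^+ m
    <= E + (n%:R - 1).
  rewrite (bigD1 i)//= eqxx lerD//.
    rewrite /E -[m%:R * _ * _]mulrA expRM_natl; apply: lerXn2r;
      rewrite ?nnegrE ?expR_ge0//.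
      by rewrite addr_ge0 ?mulr_ge0 ?sqr_ge0 ?subr_ge0 ?expr_le1.
    by apply: le_trans (expR_ge1Dx _); rewrite mulr1; lra.
  have -> : n%:R - 1 = \sum_(k < n | k != i) 1 :> R.
    rewrite sumr_const cardC1 card_ord.
    by case: (n) n_gt0 => // n' _; rewrite -natr1 addrK.
  apply: ler_sum => k; rewrite eq_sym => /negPf->; rewrite mulr0 addr0.
  by rewrite exprn_ile1 ?subr_ge0 ?expr_le1// gerBl sqr_ge0.
have : \sum_(i < n) \sum_(k < n) (1 - th ^+ 2 + n%:R * th ^+ 2 * (i == k)%:R) ^+ m
    <= n%:R * (E + (n%:R - 1)).
  apply: (@le_trans _ _ (\sum_(i < n) (E + (n%:R - 1)))).
    by apply: ler_sum => i _.
  by rewrite sumr_const card_ord mulr_natl.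
move=> h; rewrite lerBlDr.
apply: (@le_trans _ _ (n%:R ^- 2 * (n%:R * (E + (n%:R - 1))))).
  by rewrite ler_wpM2l// invr_ge0 exprn_ge0// ltW.
by rewrite le_eqVlt; apply/orP; left; apply/eqP; field; rewrite gt_eqF.
Qed.

Lemma spike_far (R : realType) (p : \bar R) (n : nat) (eps th : R) (i : 'I_n) :
  (1%:E <= p)%E -> th * (1 - n%:R^-1) = eps ->
  lp_far_from_uniform p eps (spike th i).
Proof.
move=> hp hth; rewrite /lp_far_from_uniform.
apply: le_trans (le_coord_lp_norm _ i hp).
rewrite !ffunE eqxx mulr1 -hth; apply: le_trans (ler_norm _).
by rewrite le_eqVlt; apply/orP; left; apply/eqP; ring.
Qed.

Lemma spike_bounds (R : realType) (n m : nat) (th delta : R)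
    (T : algorithm R m n) :
  (0 < n)%N -> 0 <= th <= 1 -> 0 < delta -> delta < 2^-1 -> is_algorithm T ->
  1 - delta <= verdict_prob T (uniform_distribution R n) true ->
  (forall i, verdict_prob T (spike th i) true <= delta) ->
  ln (1 + n%:R * (1 - 2 * delta) ^+ 2) <= m%:R * (n%:R - 1) * th ^+ 2 /\
  1 - 2 * delta <= m%:R * th.
Proof.
move=> n_gt0 hth hd0 hd1 hT hU hS; have /andP[th0 th1] := hth.
have n0 : 0 < n%:R :> R by rewrite ltr0n.
have cX : #|{ffun 'I_m -> 'I_n}|%:R = n%:R ^+ m :> R.
  by rewrite card_ffun !card_ord natrX.
split.
  pose Q (x : {ffun 'I_m -> 'I_n}) : R :=
    n%:R^-1 * \sum_i \prod_(j < m) spike th i (x j).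
  have Q1 : \sum_x Q x = 1.
    rewrite -mulr_sumr exchange_big /=.
    under eq_bigr => i _ do
      rewrite sum_prod_ffun (is_distribution_spike i hth).2 expr1n.
    by rewrite sumr_const card_ord mulVf// gt_eqF.
  have X0 : (0 < #|{ffun 'I_m -> 'I_n}|)%N.
    by rewrite card_ffun !card_ord expn_gt0 n_gt0.
  have ht x : 0 <= T x true <= 1 by apply: is_distribution_bounds; exact: hT.
  have := test_advantage_le_chi2 X0 ht Q1.
  rewrite cX => h.
  have {h} := le_trans h (spike_second_moment m n_gt0 hth).
  set E := expR _; set S := \sum_x _ => hS2.
  have hS1 : 1 - 2 * delta <= S.
    have -> : S = verdict_prob T (uniform_distribution R n) true -
        n%:R^-1 * \sum_i verdict_prob T (spike th i) true.
      rewrite verdict_prob_uniform /verdict_prob exchange_big mulr_sumr -sumrB.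
      apply: eq_bigr => x _.
      by rewrite /Q mulrBl exprVn -mulr_suml mulrA.
    have : n%:R^-1 * \sum_i verdict_prob T (spike th i) true <= delta.
      rewrite ler_pdivrMl//; apply: (@le_trans _ _ (\sum_(i < n) delta)).
        by apply: ler_sum => i _.
      by rewrite sumr_const card_ord mulr_natl.
    move: hU; lra.
  have hS3 : (1 - 2 * delta) ^+ 2 <= n%:R^-1 * (E - 1).
    by apply: le_trans hS2; rewrite lerXn2r ?nnegrE//; lra.
  rewrite -[leRHS]expRK ler_ln ?posrE ?expR_gt0//.
    by move: hS3; rewrite ler_pdivlMl// -/E; lra.
  by rewrite ltr_pwDl// mulr_ge0 ?sqr_ge0 ?ltW.
case: n n_gt0 n0 T hT hU hS cX => // n _ n0 T hT hU hS _.
(* A spike dominates [1 - th] times the uniform law pointwise, hence the factor [(1 - th) ^+ m] on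
   [m] samples. One fixed spike suffices here. *)
have le1 : (1 - th) ^+ m * verdict_prob T (uniform_distribution R n.+1) true
    <= verdict_prob T (spike th ord0) true.
  rewrite verdict_prob_uniform mulr_sumr; apply: ler_sum => x _.
  have /andP[t0 _] := is_distribution_bounds true (hT x).
  rewrite mulrA ler_wpM2r// -exprMn -prod_const_ord.
  apply: ler_prod => j _; rewrite mulr_ge0 ?subr_ge0 ?invr_ge0//=.
  by rewrite ffunE lerDl mulr_ge0.
(* Bernoulli's inequality. *)
have le2 : 1 - m%:R * th <= (1 - th) ^+ m.
  elim: m {T hT hU hS le1} => [|m IH]; first by rewrite mul0r subr0 expr0.
  rewrite exprSr -natr1.
  have := ler_wpM2r (_ : 0 <= 1 - th) IH; rewrite subr_ge0 => /(_ th1).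
  have : 0 <= m%:R * th ^+ 2 by rewrite mulr_ge0 ?sqr_ge0.
  by lra.
have h0 : 0 <= (1 - th) ^+ m by rewrite exprn_ge0 ?subr_ge0.
have mth : 0 <= m%:R * th by rewrite mulr_ge0.
have h1 : (1 - th) ^+ m * (1 - delta) <= delta.
  by apply: le_trans (hS ord0); apply: le_trans le1; exact: ler_wpM2l.
have h2 : (1 - m%:R * th) * (1 - delta) <= delta.
  by apply: le_trans h1; rewrite ler_wpM2r//; lra.
have h3 : 0 <= (m%:R * th) * delta by rewrite mulr_ge0// ltW.
move: h2 h3; lra.
Qed.

Theorem theorem5 (R : realType) (p : \bar R) (n : nat) (eps delta : R)
    (hp : (1%:E <= p)%E) (hn : (2 <= n)%N)
    (heps0 : 0 < eps) (heps1 : eps < 1)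
    (hdelta0 : 0 < delta) (hdelta1 : delta < 2^-1)
    (* the testing problem is not vacuous: some distribution must be rejected *)
    (hfar : exists A : {ffun 'I_n -> R},
        is_distribution A /\ lp_far_from_uniform p eps A)
    (m : nat) (T : algorithm R m n) (hT : is_algorithm T)
    (hsolves : solves_uniformity_testing p eps delta T) :
  2^-1 * (ln (1 + n%:R * (1 - 2 * delta) ^+ 2) / (n%:R * eps ^+ 2)) <= m%:R /\
  (1 / eps <= n%:R -> (1 - 2 * delta) / 2 * (1 / eps) <= m%:R).
Proof.
have n2 : 2 <= n%:R :> R by rewrite ler_nat.
have ne0 : 0 < n%:R * eps ^+ 2.
  by rewrite mulr_gt0 ?exprn_gt0//; lra.
suff [h1 h2] : ln (1 + n%:R * (1 - 2 * delta) ^+ 2) <= 2 * m%:R * (n%:R * eps ^+ 2)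
    /\ 1 - 2 * delta <= 2 * m%:R * eps.
  split=> [|_]; first by rewrite mulrA ler_pdivrMr//; lra.
  by rewrite mulrA mulr1 ler_pdivrMr//; lra.
(* Spikes of height [eps] exist only for [eps <= 1 - 1/n]; for [eps > 1/2] the
   claim amounts to [m >= 2]. *)
have [eps2|eps2] := leP eps 2^-1; last first.
  case: n hn hfar T hT hsolves n2 ne0 => // n hn [A [hA farA]] T hT hs n2 ne0.
  have m2 : 2 <= m%:R :> R.
    by rewrite ler_nat; exact: (two_samples_needed _ hA farA hT hs).
  split; last first.
    have : 2 * eps <= m%:R * eps by rewrite ler_wpM2r// ltW.
    by lra.
  have d1 : (1 - 2 * delta) ^+ 2 <= 1.
    by rewrite expr_le1//; lra.
  (* By [ln (1 + x) <= x] the logarithm is at most the support size, which [4 eps^2 >= 1] and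
     [m >= 2] absorb. *)
  apply: (@le_trans _ _ n.+1%:R).
    apply: le_trans (_ : n.+1%:R * (1 - 2 * delta) ^+ 2 <= _).
      apply: le_ln1Dx; apply: lt_le_trans (_ : 0 <= _); first exact: ltrN10.
      by rewrite mulr_ge0 ?sqr_ge0.
    by rewrite ler_piMr.
  have e4 : 1 <= 4 * eps ^+ 2 by nra.
  have h4 : 2 * (n.+1%:R * eps ^+ 2) <= m%:R * (n.+1%:R * eps ^+ 2).
    by rewrite ler_wpM2r// ltW.
  have : n.+1%:R * 1 <= n.+1%:R * (4 * eps ^+ 2) by rewrite ler_wpM2l.
  by lra.
have n_gt0 : (0 < n)%N by apply: leq_trans hn.
have n1 : 0 < n%:R - 1 :> R by lra.
(* The weight that raises the spiked coordinate by exactly [eps]; [n >= 2] gives [th <= 2 eps],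
   which is at most 1 in this case. *)
pose th := eps * n%:R / (n%:R - 1).
have hth : th * (1 - n%:R^-1) = eps.
  by rewrite /th; field; rewrite !gt_eqF//; lra.
have th2 : th <= 2 * eps.
  by rewrite /th ler_pdivrMr//; nra.
have th0 : 0 <= th by rewrite divr_ge0 ?mulr_ge0// ltW.
have hth01 : 0 <= th <= 1.
  by rewrite th0; lra.
have hU := is_distribution_uniform R n_gt0.
have hUt := (hsolves _ hU).1 erefl.
have hS i : verdict_prob T (spike th i) true <= delta.
  have hA := is_distribution_spike i hth01.
  have := (hsolves _ hA).2 (spike_far i hp hth).
  by have := verdict_prob_sum hT hA; lra.
have [h1 h2] := spike_bounds n_gt0 hth01 hdelta0 hdelta1 hT hUt hS.
split.
  apply: le_trans h1 _.
  (* One factor [th] cancels [n - 1] exactly; only the other is bounded by [2 eps]. *)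
  have -> : m%:R * (n%:R - 1) * th ^+ 2 = m%:R * (th * (n%:R * eps)).
    by rewrite /th; field; rewrite gt_eqF.
  have -> : 2 * m%:R * (n%:R * eps ^+ 2) = m%:R * (2 * eps * (n%:R * eps)) by ring.
  by rewrite ler_wpM2l// ler_wpM2r// mulr_ge0// ltW.
apply: le_trans h2 _; rewrite (_ : 2 * m%:R * eps = m%:R * (2 * eps)); last ring.
by rewrite ler_wpM2l.
Qed.
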